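(* For any $\varepsilon>0$ and $d=\Omega(1/\varepsilon)$, any coreset-based randomized streaming algorithm that answers approximate farthest-neighbor queries, or maintains an approximate farthest pair, for a stream of points in $\mathbb{R}^d$ with multiplicative error at most $\sqrt{2}+\varepsilon$ (with sufficiently high constant probability) has to store $\Omega(1/\varepsilon)$ points.
   Context: A stream $S$ of points in $\mathbb{R}^d$ arrives one at a time. A coreset-based streaming algorithm may store input points; its space is measured by the number of input points stored, a point once deleted from memory (or discarded) can never be retrieved, and upon a query it must return a stored input point (two stored input points for the farthest pair). Answering a farthest-neighbor query $x\in\mathbb{R}^d$ with multiplicative error at most $\alpha$ means returning $y\in S$ with $\lVert xp\rVert\le\alpha\lVert xy\rVert$ for all $p\in S$; maintaining a farthest pair with error at most $\alpha$ means returning $p,\bar p\in S$ with $\max_{a,b\in S}\lVert ab\rVert\le\alpha\lVert p\bar p\rVert$, where $\lVert\cdot\rVert$ is Euclidean distance. *)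

(* Defs.v *)
From mathcomp Require Import all_boot all_order all_algebra.
From mathcomp Require Import all_classical all_reals all_analysis.
Import Order.TTheory GRing.Theory Num.Theory.

Set Implicit Arguments.
Unset Strict Implicit.
Unset Printing Implicit Defensive.

Local Open Scope classical_set_scope.
Local Open Scope ring_scope.

(* The library norm on 'rV[R]_d is the sup norm, hence this definition. *)
Definition edist (R : realType) (d : nat) (x y : 'rV[R]_d) : R :=
  Num.sqrt (\sum_(i < d) (x ord0 i - y ord0 i) ^+ 2).

(* w : Om is the outcome of the random source. It is visible to every step, so
   fresh coins and shared randomness are both covered. A memory state may carry
   arbitrary information besides the stored points, and only the latter
   count as space. *)
Record coreset_alg (R : realType) (d : nat) (Om : Type) := CoresetAlg {
  memory : Type;
  start : memory;
  insert : Om -> 'rV[R]_d -> memory -> memory;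
  stored : memory -> seq 'rV[R]_d;
  stored_start : stored start = [::];
  stored_insert : forall w x m, {subset stored (insert w x m) <= x :: stored m}
}.

Definition run (R : realType) (d : nat) (Om : Type) (A : coreset_alg R d Om)
    (w : Om) (S : seq 'rV[R]_d) : memory A :=
  foldl (fun m x => insert w x m) (start A) S.

(* Every prefix of a stream is itself a stream, so this bounds the number of
   stored points at all times. *)
Definition stores_at_most (R : realType) (d : nat) (disp : measure_display)
    (Om : measurableType disp) (P : probability Om R)
    (A : coreset_alg R d Om) (s : nat) : Prop :=
  forall S : seq 'rV[R]_d,
    {ae P, forall w, (size (stored (run A w S)) <= s)%N}.

Definition approx_farthest_neighbor (R : realType) (d : nat) (alpha : R)
    (S : seq 'rV[R]_d) (x y : 'rV[R]_d) : Prop :=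
  y \in S /\ forall p, p \in S -> edist x p <= alpha * edist x y.

Definition approx_farthest_pair (R : realType) (d : nat) (alpha : R)
    (S : seq 'rV[R]_d) (p q : 'rV[R]_d) : Prop :=
  [/\ p \in S, q \in S &
      forall a b, a \in S -> b \in S -> edist a b <= alpha * edist p q].

(* The answer None is a failure. The success probability is required for each
   fixed stream and query separately; the measurability clause makes the answer
   a discrete random variable, so that the success event is measurable. *)
Definition answers_farthest_neighbor (R : realType) (d : nat)
    (disp : measure_display) (Om : measurableType disp) (P : probability Om R)
    (A : coreset_alg R d Om)
    (answer : Om -> memory A -> 'rV[R]_d -> option 'rV[R]_d)
    (alpha prob : R) : Prop :=
  [/\ forall w m x y, answer w m x = Some y -> y \in stored m,
      forall S x o, measurable [set w | answer w (run A w S) x = o] &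
      forall S x, S != [::] ->
        (prob%:E <= P [set w | exists2 y, answer w (run A w S) x = Some y &
                                  approx_farthest_neighbor alpha S x y])%E].

Definition maintains_farthest_pair (R : realType) (d : nat)
    (disp : measure_display) (Om : measurableType disp) (P : probability Om R)
    (A : coreset_alg R d Om)
    (answer : Om -> memory A -> option ('rV[R]_d * 'rV[R]_d))
    (alpha prob : R) : Prop :=
  [/\ forall w m p q, answer w m = Some (p, q) ->
        p \in stored m /\ q \in stored m,
      forall S o, measurable [set w | answer w (run A w S) = o] &
      forall S, (1 < size S)%N ->
        (prob%:E <= P [set w | exists p q, answer w (run A w S) = Some (p, q) /\
                                  approx_farthest_pair alpha S p q])%E].

(* Main.v *)
(* Take orthonormal vertices v_i, i in D, with #|D| = m + 1, and let x_i be
   -v_i + (2 / m) * \sum_(j != i) v_j. Then x_i is at distance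
   sqrt (4 + 4 / m) from v_i and sqrt 2 from every other vertex, a ratio of
   sqrt (2 + 2 / m), which exceeds sqrt 2 + eps when m is a small multiple of
   1 / eps. So the query x_i, or the insertion of x_i after all the vertices,
   can only be answered correctly if v_i was stored beforehand. The memory
   after the vertices does not depend on i, hence summing the success
   probabilities over i bounds the expected number of stored vertices from
   below by prob * #|D|. *)
Require Import Defs.
From mathcomp Require Import all_boot all_order all_algebra.
From mathcomp Require Import all_classical all_reals all_analysis.
From mathcomp Require Import measurable_realfun ring lra zify.
Import Order.TTheory GRing.Theory Num.Theory.
Local Open Scope ring_scope.

Set Implicit Arguments.
Unset Strict Implicit.

(* [all_analysis] exports another constant of the same name. *)
Local Notation edist := Defs.edist.

(** * Distances between vertices and antipodes *)

Lemma edist_sym (R : realType) (d : nat) (x y : 'rV[R]_d) :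
  edist x y = edist y x.
Proof. by congr Num.sqrt; apply: eq_bigr => i _; rewrite -sqrrN opprB. Qed.

Lemma edist_refl (R : realType) (d : nat) (x : 'rV[R]_d) : edist x x = 0.
Proof.
by rewrite /edist big1 ?sqrtr0 // => i _; rewrite subrr expr0n.
Qed.

Definition vertex (R : realType) (d : nat) (i : 'I_d) : 'rV[R]_d :=
  delta_mx ord0 i.

(* For a singleton [D] the junk value of [2 / 0] is never used. *)
Definition antipode (R : realType) (d : nat) (D : {set 'I_d}) (i : 'I_d) :
    'rV[R]_d :=
  \row_k (if k == i then -1 else if k \in D then 2 / #|D|.-1%:R else 0).

Lemma vertex_inj (R : realType) (d : nat) : injective (@vertex R d).
Proof.
move=> i j /rowP/(_ i); rewrite !mxE !eqxx /=.
by case: eqVneq => // _ /eqP; rewrite oner_eq0.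
Qed.

Lemma antipode_neq_vertex (R : realType) (d : nat) (D : {set 'I_d}) (i : 'I_d) :
  vertex R i != antipode R D i.
Proof.
by apply/eqP => /rowP/(_ i); rewrite !mxE !eqxx /=; lra.
Qed.

Lemma edist_vertices (R : realType) (d : nat) (i j : 'I_d) :
  i != j -> edist (vertex R i) (vertex R j) = Num.sqrt 2.
Proof.
move=> ij; rewrite /edist (bigD1 i) //= (bigD1 j) ?(eq_sym j) //= big1.
  by rewrite !mxE !eqxx /= (eq_sym j) (negPf ij) /=; congr Num.sqrt; ring.
move=> k /andP[ki kj]; rewrite !mxE eqxx /= (negPf ki) (negPf kj) /=.
by rewrite subrr expr0n.
Qed.

Lemma edist_antipode_vertex (R : realType) (d : nat) (D : {set 'I_d})
    (i : 'I_d) : i \in D ->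
  edist (antipode R D i) (vertex R i) = Num.sqrt (4 + 4 / #|D|.-1%:R).
Proof.
move=> iD; rewrite /edist (bigD1 i) //= !mxE !eqxx /=; congr Num.sqrt.
have -> : (-1 - 1 : R) ^+ 2 = 4 by ring.
congr (_ + _).
rewrite (bigID [in D]) /= [X in _ + X]big1 ?addr0; last first.
  move=> k /andP[ki kD]; rewrite !mxE eqxx /= (negPf ki) (negPf kD).
  by rewrite subrr expr0n.
rewrite (eq_bigr (fun=> (2 / #|D|.-1%:R) ^+ 2)); last first.
  by move=> k /andP[ki kD]; rewrite !mxE eqxx /= (negPf ki) kD subr0.
rewrite sumr_const.
have -> : #|[pred k | k != i & k \in D]| = #|D|.-1.
  by rewrite (cardsD1 i D) iD /=; apply: eq_card => k; rewrite !inE.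
(* For a singleton [D] both sides vanish, since the inverse of 0 is 0. *)
have [->|m0] := eqVneq (#|D|.-1%:R : R) 0.
  by rewrite invr0 !mulr0 expr0n mul0rn.
rewrite -mulr_natr; field.
exact: m0.
Qed.

(** A coordinate a at the other vertices gives the squared distance 1 + (a - 1)^2 + (n - 1) a^2 = 2
    - 2 a + n a^2, where n is [#|D|.-1]; the nonzero a that makes this equal to 2 is 2 / n. *)
Lemma edist_antipode_other (R : realType) (d : nat) (D : {set 'I_d})
    (i j : 'I_d) : i \in D -> j \in D -> j != i ->
  edist (antipode R D i) (vertex R j) = Num.sqrt 2.
Proof.
move=> iD jD ji; rewrite /edist (bigD1 i) //= (bigD1 j) //=.
rewrite !mxE !eqxx /= (negPf ji) jD eq_sym (negPf ji) /=; congr Num.sqrt.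
rewrite (bigID [in D]) /= [X in _ + (_ + (_ + X))]big1 ?addr0; last first.
  move=> k /andP[/andP[ki kj] kD].
  by rewrite !mxE eqxx /= (negPf ki) (negPf kj) (negPf kD) subrr expr0n.
rewrite (eq_bigr (fun=> (2 / #|D|.-1%:R) ^+ 2)); last first.
  move=> k /andP[/andP[ki kj] kD].
  by rewrite !mxE eqxx /= (negPf ki) (negPf kj) kD subr0.
rewrite sumr_const.
have e : #|D| = #|[pred k | (k != i) && (k != j) & k \in D]|.+2.
  rewrite (cardsD1 i D) iD (cardsD1 j (D :\ i)) !inE ji jD /= !add1n.
  congr _.+2; apply: eq_card => k; rewrite !inE.
  by case: (k == i); case: (k == j); rewrite ?andbF.
rewrite e /=; set m := #|_|; rewrite -mulr_natr -(natr1 m).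
field.
by rewrite natr1 pnatr_eq0.
Qed.

Lemma sqrt_gap (R : realType) (alpha : R) (m : nat) :
  0 <= alpha -> (0 < m)%N -> alpha ^+ 2 * m%:R < 2 * m%:R + 2 ->
  alpha * Num.sqrt 2 < Num.sqrt (4 + 4 / m%:R).
Proof.
move=> a0 m0 h; have mp : 0 < m%:R :> R by rewrite ltr0n.
rewrite -{1}(ger0_norm a0) -sqrtr_sqr -sqrtrM ?sqr_ge0 // ltr_sqrt; last first.
  by rewrite ltr_pwDl // divr_ge0 // ltW.
rewrite -(ltr_pM2r mp) mulrDl divfK ?gt_eqF //; lra.
Qed.

(* Any two points of the stream other than [vertex i] are at distance at most
   [Num.sqrt 2], and the antipode is too far from [vertex i] for that. *)
Lemma vertex_needed (R : realType) (d : nat) (D : {set 'I_d}) (i : 'I_d)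
    (alpha : R) (p q : 'rV[R]_d) :
  0 <= alpha -> alpha ^+ 2 * #|D|.-1%:R < 2 * #|D|.-1%:R + 2 -> i \in D ->
  let S := rcons [seq vertex R j | j <- enum D] (antipode R D i) in
  p \in S -> q \in S -> p != vertex R i -> q != vertex R i ->
  alpha * edist p q < edist (antipode R D i) (vertex R i).
Proof.
move=> a0 ha iD S.
have card_gt0 j : j \in D -> j != i -> (0 < #|D|.-1)%N.
  by move=> jD ji; rewrite (cardsD1 i D) iD (cardsD1 j (D :\ i)) !inE ji jD.
(* This settles the cases where the two points coincide, and it holds even for a singleton [D]. *)
have dpos : 0 < edist (antipode R D i) (vertex R i).
  by rewrite edist_antipode_vertex // sqrtr_gt0 ltr_pwDl //.
have SP r : r \in S -> r != vertex R i ->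
    r = antipode R D i \/ exists j, [/\ j \in D, j != i & r = vertex R j].
  rewrite mem_rcons inE => /orP[/eqP|/mapP[j]]; first by left.
  rewrite mem_enum => jD -> ne; right; exists j; split => //.
  by apply: contraNneq ne => ->.
have gap j : j \in D -> j != i ->
    alpha * Num.sqrt 2 < edist (antipode R D i) (vertex R i).
  move=> jD ji; rewrite edist_antipode_vertex //.
  by apply/sqrt_gap/ha => //; exact: card_gt0 ji.
move=> pS qS pi qi.
case: (SP _ pS pi) => [->|[j [jD ji ->]]];
  case: (SP _ qS qi) => [->|[k [kD ki ->]]].
- by rewrite edist_refl mulr0.
- by rewrite edist_antipode_other //; exact: gap kD ki.
- by rewrite edist_sym edist_antipode_other //; exact: gap jD ji.
- have [->|jk] := eqVneq j k; first by rewrite edist_refl mulr0.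
  by rewrite edist_vertices //; exact: gap jD ji.
Qed.

(** * From success probabilities to expected storage *)

Lemma measurable_option_success (disp : measure_display)
    (Om : measurableType disp) (T : eqType) (f : Om -> option T) (L : seq T)
    (Q : T -> Prop) :
  (forall o, measurable [set w | f w = o]%classic) ->
  (forall y, Q y -> y \in L) ->
  measurable [set w | exists2 y, f w = Some y & Q y]%classic.
Proof.
move=> mf QL.
(* Only the finitely many elements of [L] can be correct answers, so this is a finite union of level
   sets of [f]. *)
have -> : [set w | exists2 y, f w = Some y & Q y]%classic =
    (\bigcup_(y in Q) [set w | f w = Some y])%classic.
  by apply/seteqP; split => w [y]; exists y.
apply: fin_bigcup_measurable => //.
by apply: (@sub_finite_set _ _ [set` L]%classic) => //; exact: finite_seq.
Qed.

(** Linearity of expectation. Nothing says that the size of [st w] is measurable in [w], so only the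
    indicators of the events [E i] are integrated, and their sum is compared almost everywhere with
    the constant [s]. *)
Lemma expected_storage (R : realType) (disp : measure_display)
    (Om : measurableType disp) (P : probability Om R) (I : finType) (D : {set I})
    (T : eqType) (v : I -> T) (st : Om -> seq T) (E : I -> set Om) (prob : R)
    (s : nat) :
  injective v -> (forall i, measurable (E i)) ->
  (forall i, i \in D -> (prob%:E <= P (E i))%E) ->
  (forall i w, i \in D -> E i w -> v i \in st w) ->
  {ae P, forall w, (size (st w) <= s)%N} ->
  prob * #|D|%:R <= s%:R.
Proof.
move=> vinj mE PE Est sts.
have mI i : measurable_fun setT (EFin \o \1_(E i) : Om -> \bar R).
  by apply/measurable_EFinP; exact: measurable_indic.
have sumP : (\int[P]_w (\sum_(i <- enum D) (\1_(E i) w)%:E) =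
    \sum_(i <- enum D) P (E i))%E.
  rewrite ge0_integral_sum //.
  by apply: eq_bigr => i _; rewrite integral_indic // setIT.
rewrite -lee_fin; apply: (@le_trans _ _ (\sum_(i <- enum D) P (E i))%E).
  rewrite mulr_natr -sumr_const -sumEFin -big_enum /=.
  rewrite !big_seq; apply: lee_sum => i; rewrite mem_enum; exact: PE.
rewrite -sumP.
have -> : s%:R%:E = (\int[P]_w (cst s%:R%:E w))%E :> \bar R.
  by rewrite integral_cst //= probability_setT mule1.
apply: ae_ge0_le_integral => //.
- by move=> w _; apply: sume_ge0.
- exact: emeasurable_sum.
- by move=> w _; rewrite lee_fin.
apply: filterS sts => w sw _ /=.
rewrite sumEFin lee_fin.
have -> : \sum_(i <- enum D) \1_(E i) w =
    (size [seq i <- enum D | w \in E i])%:R :> R.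
  rewrite size_filter -sum1_count natr_sum [RHS]big_mkcond /=.
  by apply: eq_bigr => i _; rewrite indicE; case: (w \in E i).
(* The events that occur at [w] yield pairwise distinct members of [st w], by injectivity of [v]. *)
rewrite ler_nat; apply: leq_trans sw; rewrite -(size_map v).
apply: uniq_leq_size; first by rewrite map_inj_uniq // filter_uniq // enum_uniq.
move=> _ /mapP[i + ->]; rewrite mem_filter mem_enum => /andP[/set_mem Ei iD].
exact: Est Ei.
Qed.

(** * Storage bounds for the two problems *)

Lemma farthest_neighbor_storage (R : realType) (d : nat) (D : {set 'I_d})
    (disp : measure_display) (Om : measurableType disp) (P : probability Om R)
    (A : coreset_alg R d Om)
    (answer : Om -> memory A -> 'rV[R]_d -> option 'rV[R]_d)
    (alpha prob : R) (s : nat) :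
  0 <= alpha -> alpha ^+ 2 * #|D|.-1%:R < 2 * #|D|.-1%:R + 2 ->
  answers_farthest_neighbor P answer alpha prob -> stores_at_most P A s ->
  prob * #|D|%:R <= s%:R.
Proof.
move=> a0 ha [ans_st mans pans] hs.
pose S := [seq vertex R j | j <- enum D].
apply: (@expected_storage _ _ _ P _ D _ (@vertex R d)
  (fun w => stored (run A w S))
  (fun i => [set w | exists2 y, answer w (run A w S) (antipode R D i) = Some y &
             approx_farthest_neighbor alpha S (antipode R D i) y]%classic)).
- exact: vertex_inj.
- by move=> i; apply: (@measurable_option_success _ _ _ _ S) => // y [].
- move=> i iD; apply: pans.
  by apply/eqP => /(congr1 (fun t => vertex R i \in t)); rewrite map_f // mem_enum.
- move=> i w iD [y /ans_st yst [yS yfar]].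
  have [<-//|yi] := eqVneq y (vertex R i).
  have viS : vertex R i \in S by rewrite map_f // mem_enum.
  have := yfar _ viS; rewrite leNgt => /negP[].
  (* Here the antipode is the query and not a stream point; it serves as the first point of the
     pair, the wrong answer [y] as the second. *)
  apply: vertex_needed => //; rewrite ?mem_rcons ?inE ?eqxx ?yS ?orbT //.
  by rewrite eq_sym antipode_neq_vertex.
- exact: hs.
Qed.

Lemma farthest_pair_storage (R : realType) (d : nat) (D : {set 'I_d})
    (disp : measure_display) (Om : measurableType disp) (P : probability Om R)
    (A : coreset_alg R d Om)
    (answer : Om -> memory A -> option ('rV[R]_d * 'rV[R]_d))
    (alpha prob : R) (s : nat) :
  0 <= alpha -> alpha ^+ 2 * #|D|.-1%:R < 2 * #|D|.-1%:R + 2 ->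
  maintains_farthest_pair P answer alpha prob -> stores_at_most P A s ->
  prob * #|D|%:R <= s%:R.
Proof.
move=> a0 ha [ans_st mans pans] hs.
pose S0 := [seq vertex R j | j <- enum D].
pose S i := rcons S0 (antipode R D i).
apply: (@expected_storage _ _ _ P _ D _ (@vertex R d)
  (fun w => stored (run A w S0))
  (fun i => [set w | exists p q, answer w (run A w (S i)) = Some (p, q) /\
             approx_farthest_pair alpha (S i) p q]%classic)).
- exact: vertex_inj.
- move=> i.
  (* The two existentials are merged into one over pairs, to fit [measurable_option_success]. *)
  have -> : [set w | exists p q, answer w (run A w (S i)) = Some (p, q) /\
             approx_farthest_pair alpha (S i) p q]%classic =
    [set w | exists2 y, answer w (run A w (S i)) = Some y &
             approx_farthest_pair alpha (S i) y.1 y.2]%classic.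
    apply/seteqP; split => w /=; first by move=> [p [q []]]; exists (p, q).
    by move=> [[p q] ? ?]; exists p, q.
  apply: (@measurable_option_success _ _ _ _ [seq (p, q) | p <- S i, q <- S i]) => //.
  by move=> [p q] [pS qS _]; rewrite allpairs_f.
- move=> i iD; apply: pans.
  by rewrite size_rcons size_map -cardE ltnS (cardD1 i) iD.
- move=> i w iD [p [q [/ans_st[pst qst] [pS qS pqfar]]]].
  have viS : vertex R i \in S i by rewrite mem_rcons inE map_f ?orbT // mem_enum.
  have xS : antipode R D i \in S i by rewrite mem_rcons inE eqxx.
  have : vertex R i \in stored (run A w (S i)).
    have [<-//|pi] := eqVneq p (vertex R i).
    have [<-//|qi] := eqVneq q (vertex R i).
    have := pqfar _ _ xS viS; rewrite leNgt => /negP[].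
    exact: vertex_needed.
  (* The last insertion can add only the antipode to memory, so [vertex R i] was already stored
     after [S0], a stream common to all [i]. *)
  rewrite /run /S foldl_rcons => h; have := stored_insert h.
  by rewrite inE (negPf (antipode_neq_vertex _ _ _)).
- exact: hs.
Qed.

(** * Choice of the number of vertices *)

Lemma stretch_bound (R : realType) (eps : R) (m : nat) :
  0 < eps -> m.+1%:R * (2 * eps) <= 1 ->
  (Num.sqrt 2 + eps) ^+ 2 * m%:R < 2 * m%:R + 2.
Proof.
move=> e0; rewrite -natr1 => hm.
have q2 : Num.sqrt 2 ^+ 2 = 2 :> R by rewrite sqr_sqrtr.
have q0 : 0 <= Num.sqrt 2 :> R by exact: sqrtr_ge0.
have q : Num.sqrt 2 <= 3 / 2 :> R by nra.
have m0 : 0 <= m%:R :> R by exact: ler0n.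
rewrite sqrrD q2.
have me : m%:R * eps <= 1 / 2 by nra.
have e1 : eps <= 1 / 2 by nra.
have me0 : 0 <= m%:R * eps by rewrite mulr_ge0 // ltW.
have -> : (2 + Num.sqrt 2 * eps *+ 2 + eps ^+ 2) * m%:R =
  2 * m%:R + (m%:R * eps) * (2 * Num.sqrt 2 + eps) :> R by rewrite -mulr_natr; ring.
(* The product is at most 1/2 times (3 + 1/2), that is 7/4, which is below 2. *)
rewrite ltrD2l; nra.
Qed.

Lemma exists_card_set (d n : nat) : (n <= d)%N -> exists D : {set 'I_d}, #|D| = n.
Proof.
move=> nd; exists [set widen_ord nd i | i : 'I_n].
rewrite card_imset ?card_ord // => i j /(congr1 val) /= ij; exact: val_inj.
Qed.

Lemma exists_simplex_size (R : realType) (C eps : R) (d : nat) :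
  0 < C -> 0 < eps -> C / eps <= d%:R ->
  exists D : {set 'I_d},
    (Num.sqrt 2 + eps) ^+ 2 * #|D|.-1%:R < 2 * #|D|.-1%:R + 2 /\
    Num.min (C / 2) (1 / 8) / eps <= 1 / 2 * #|D|%:R.
Proof.
move=> C0 e0 hd.
have d0 : (0 < d)%N.
  by rewrite -(ltr_nat R); apply: lt_le_trans hd; rewrite divr_gt0.
pose k := Num.trunc (1 / (2 * eps)).
have e20 : 0 < 2 * eps by lra.
have ke : 1 < (k.+1)%:R * (2 * eps).
  by rewrite -ltr_pdivrMr // truncnS_gt.
have kle : k%:R * (2 * eps) <= 1.
  by rewrite -ler_pdivlMr // truncn_le // divr_ge0 // ltW.
(* [stretch_bound] allows up to [k] vertices and the dimension up to [d]. For large [eps], [k] is 0;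
   a single vertex then suffices, as the ratio condition reads 0 < 2. *)
pose n := maxn 1 (minn d k).
have [D cD] := @exists_card_set d n ltac:(by rewrite geq_max d0 geq_minl).
exists D; rewrite cD; split.
  have [->|n1] := eqVneq n 1%N; first by rewrite !mulr0 add0r.
  apply: stretch_bound => //.
  have n0 : (0 < n)%N by rewrite leq_max.
  rewrite prednK //; apply: le_trans kle; rewrite ler_pM2r // ler_nat.
  by move: n1; rewrite /n; lia.
rewrite ler_pdivrMr //.
have [dk|kd] := leqP d k.
  have -> : n = d by rewrite /n; lia.
  apply: le_trans (_ : C / 2 <= _); first by rewrite ge_min lexx.
  by move: hd; rewrite ler_pdivrMr //; lra.
(* With [ke] this gives 1 < 4 n eps, hence the constant 1/8 once the factor 1/2 is included. *)
have kn : (k.+1 <= 2 * n)%N by rewrite /n; lia.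
apply: le_trans (_ : 1 / 8 <= _); first by rewrite ge_min lexx orbT.
move: kn; rewrite -(ler_nat R) natrM => kn.
have : k.+1%:R * (2 * eps) <= 2 * n%:R * (2 * eps) by rewrite ler_pM2r.
lra.
Qed.

Theorem theorem10 (R : realType) :
  exists2 prob : R, 0 < prob < 1 &
  forall C : R, 0 < C ->
  exists2 c : R, 0 < c &
  forall (eps : R) (d : nat), 0 < eps -> C / eps <= d%:R ->
  forall (disp : measure_display) (Om : measurableType disp)
    (P : probability Om R) (A : coreset_alg R d Om),
    (forall answer : Om -> memory A -> 'rV[R]_d -> option 'rV[R]_d,
       answers_farthest_neighbor P answer (Num.sqrt 2 + eps) prob ->
       forall s : nat, stores_at_most P A s -> c / eps <= s%:R)
    /\
    (forall answer : Om -> memory A -> option ('rV[R]_d * 'rV[R]_d),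
       maintains_farthest_pair P answer (Num.sqrt 2 + eps) prob ->
       forall s : nat, stores_at_most P A s -> c / eps <= s%:R).
Proof.
(* This probability is the factor 1/2 in front of [#|D|] in [exists_simplex_size]. *)
exists (1 / 2); first by lra.
move=> C C0; exists (Num.min (C / 2) (1 / 8)).
  by rewrite lt_min; apply/andP; split; lra.
move=> eps d e0 hd disp Om P A.
have [D [ratio size_le]] := exists_simplex_size C0 e0 hd.
have a0 : 0 <= Num.sqrt 2 + eps by rewrite addr_ge0 ?sqrtr_ge0 // ltW.
split => answer hans s hs; apply: le_trans size_le _.
  exact: farthest_neighbor_storage hans hs.
exact: farthest_pair_storage hans hs.
Qed.
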